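(* Let $r\ge 2$ be an integer and let $S_0^r\in\{0,1\}^{3\times4\times1\times\cdots\times1}$ be the $r$-dimensional 0--1 matrix whose last $r-2$ dimensions have width 1 and whose entries are given by the $3\times 4$ matrix $$S_0=\begin{pmatrix}1&0&1&0\\1&0&0&1\\0&1&0&1\end{pmatrix}.$$ Then the vertex-ordered $r$-uniform hypergraph $H(S_0^r)$ is a forest with interval chromatic number $r$, and $$\mathrm{Ex}_<^r(H(S_0^r),n)=\Omega\big(n^{r-1}2^{\sqrt{\log n}-O(\log\log n)}\big)\quad\text{as } n\to\infty .$$ Consequently, for every $r\ge2$ it is false that for every $r$-uniform vertex-ordered forest $F$ with interval chromatic number $r$ there is a constant $c(F)$ with $\mathrm{Ex}_<^r(F,n)=O(n^{r-1}\log^{c(F)}n)$.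
   Context: $\log$ is the binary logarithm. A vertex-ordered hypergraph is a hypergraph with a linear order on its vertex set. For an $r$-uniform vertex-ordered hypergraph $H$, $\mathrm{Ex}_<^r(H,n)$ is the maximum number of edges in an $r$-uniform vertex-ordered hypergraph on $n$ vertices not containing any subgraph order-isomorphic to $H$ (isomorphic via an order-preserving bijection of vertices). The interval chromatic number $\chi_<(H)$ is the smallest number of intervals (with respect to the order on $V(H)$) that $V(H)$ can be partitioned into such that each hyperedge intersects $r$ distinct intervals. A hypergraph is a forest if its edges can be ordered $e_1,\dots,e_{|E|}$ so that for all $i<|E|$ there exists $h>i$ with $e_i\cap\bigcup_{j>i}e_j\subseteq e_h$. For an $r$-dimensional 0--1 matrix $P\in\{0,1\}^{k_1\times\cdots\times k_r}$, $H(P)$ is the vertex-ordered $r$-uniform hypergraph with $k_1+\cdots+k_r$ vertices $i^{(j)}$ ($1\le j\le r$, $1\le i\le k_j$), ordered primarily by the axis $j$ and then by the coordinate $i$ within the axis, having one hyperedge $\{i_1^{(1)},\dots,i_r^{(r)}\}$ for each entry $P(i_1,\dots,i_r)=1$. *)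

(* Defs.v *)
From HB Require Import structures.
From mathcomp Require Import all_boot all_order all_algebra.

Set Implicit Arguments.
Unset Strict Implicit.
Unset Printing Implicit Defensive.

Import Order.TTheory GRing.Theory Num.Theory.

(* A vertex-ordered hypergraph is given by its edge set [E : {set {set V}}]
   over a finite totally ordered vertex type [V]; all of [V] is the vertex set,
   isolated vertices included. *)

Definition uniform (V : finType) (r : nat) (E : {set {set V}}) : bool :=
  [forall e in E, #|e| == r].

(* The edges are listed from index 0, so the range 1 <= i < |E| becomes
   [i.+1 < size s]. *)
Definition is_forest (V : finType) (E : {set {set V}}) : Prop :=
  exists s : seq {set V},
    [/\ uniq s, s =i E &
        forall i, i.+1 < size s ->
          exists h, [/\ i < h, h < size s &
            nth set0 s i :&: \bigcup_(i.+1 <= j < size s) nth set0 s j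
              \subset nth set0 s h]].

Definition order_convex d (V : finOrderType d) (B : {set V}) : bool :=
  [forall x in B, forall z in B, forall y, ((x <= y) && (y <= z))%O ==> (y \in B)].

Definition proper_interval_partition d (V : finOrderType d) (r : nat)
    (E : {set {set V}}) (P : {set {set V}}) : bool :=
  [&& partition P [set: V],
      [forall B in P, order_convex B] &
      [forall e in E, #|[set B in P | e :&: B != set0]| == r]].

(* When [E] is [r]-uniform the partition of [V] into singletons is proper and has
   [#|V|] blocks, so the default value [#|V|] is itself attained. *)
Definition interval_chromatic_number d (V : finOrderType d) (r : nat)
    (E : {set {set V}}) : nat :=
  \big[minn/#|V|]_(P | proper_interval_partition r E P) #|P|.

Definition subhypergraph (W : finType) (B : {set W}) (F G : {set {set W}}) : bool :=
  (F \subset G) && [forall e in F, e \subset B].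

(* [(V, E)] is order-isomorphic to the hypergraph with vertex set [B] and edge
   set [F], where [B] carries the order induced by [W]. *)
Definition order_isomorphic dV (V : finOrderType dV) dW (W : finOrderType dW)
    (E : {set {set V}}) (B : {set W}) (F : {set {set W}}) : bool :=
  [exists f : {ffun V -> W},
    [&& [forall x, forall y, (x < y)%O == (f x < f y)%O],
        f @: [set: V] == B &
        [set f @: e | e : {set V} in E] == F]].

Definition contains dV (V : finOrderType dV) dW (W : finOrderType dW)
    (E : {set {set V}}) (G : {set {set W}}) : bool :=
  [exists B : {set W}, exists F : {set {set W}},
    subhypergraph B F G && order_isomorphic E B F].

(* Every linear order on [n] vertices is isomorphic to ['I_n]. *)
Definition Ex d (V : finOrderType d) (r : nat) (E : {set {set V}}) (n : nat) : nat :=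
  \max_(G : {set {set 'I_n}} | uniform r G && ~~ contains E G) #|G|.

(* Vertex [i^(j)] is the pair with first component the axis [j] and second component
   the coordinate [i]; dependent pairs are ordered lexicographically, so by axis
   first and by coordinate within an axis. *)
Notation matrix_vertex k := {j & 'I_(k j)}.

(* A 0-1 matrix of dimensions [k 0 x ... x k (r-1)] is a boolean function on
   index tuples. *)
Definition matrix_hypergraph (r : nat) (k : 'I_r -> nat)
    (P : pred {dffun forall j : 'I_r, 'I_(k j)}) : {set {set matrix_vertex k}} :=
  [set [set (Tagged (fun j => 'I_(k j)) (x j) : matrix_vertex k) | j : 'I_r]
    | x : {dffun forall j : 'I_r, 'I_(k j)} & P x].

Definition S0 : 'M[bool]_(3, 4) :=
  \matrix_(i, j) nth false (nth [::]
    [:: [:: true;  false; true;  false];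
        [:: true;  false; false; true ];
        [:: false; true;  false; true ]] i) j.

Definition S0r_dim (r : nat) (j : 'I_r) : nat := nth 1 [:: 3; 4] j.

Definition S0r (r : nat) (hr : 2 <= r) :
    pred {dffun forall j : 'I_r, 'I_(S0r_dim j)} :=
  fun x => S0 (x (Ordinal (ltnW hr))) (x (Ordinal hr)).

(* Imported only here: the notations of classical_sets would shadow finset's. *)
From mathcomp Require Import reals exp.

Definition log2 (R : realType) (x : R) : R := (ln x / ln 2)%R.

(* Main.v *)
Require Import Defs.
From mathcomp Require Import all_boot all_order all_algebra.
From mathcomp Require Import zify ring.

Set Implicit Arguments.
Unset Strict Implicit.
Unset Printing Implicit Defensive.

Import Order.TTheory GRing.Theory Num.Theory.

(* Let B = 2^m and let X(x) be the number whose base-8B digits are the m binary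
   digits of x. Take rows (S, p) with 1 <= p <= B, ordered by S and then by
   decreasing p, columns (T, x) with 0 < x < B in lexicographic order, and put a 1
   where T = S + p X(x).
   In a copy of S0, two rows sharing a column satisfy S' - S = (p - p') X(x), so
   p1 > p2 > p3. The column order makes E = X3 - X1, D = X4 - X1 and F = X4 - X2
   positive and p1 E <= p2 D, p3 F <= p2 D <= p1 E + p3 F. Differences of values of
   X are powers of 8B up to a small relative error; since p1 > p2 the power
   belonging to E is below that of D, so p1 E is negligible, and since p3 < p2 the
   term p3 F is too small to reach p2 D.
   S and T only have to range over intervals of length about (8B)^m, so a row has
   B - 1 ones in a matrix of size 2^(m^2 + O(m)), which is n 2^(sqrt(log n) - O(1))
   ones: even a bounded g will do.
   For r > 2 the n vertices are cut into r blocks of length n / r, the first two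
   blocks carrying the matrix. *)

(** * The matrix *)

(** With base [q.+1], geometric sums of digits are bounded through multiples of [q], without
    division. *)
Fixpoint rebase (q m x : nat) : nat :=
  if m is m'.+1 then odd x + q.+1 * rebase q m' x./2 else 0.

Lemma rebase0 q m : rebase q m 0 = 0.
Proof. by elim: m => //= m ->; rewrite muln0. Qed.

(** All digits are at most 1, so the value is at most the geometric sum [((q+1)^m - 1) / q]. *)
Lemma rebase_le q m x : q * rebase q m x < q.+1 ^ m.
Proof.
elim: m x => [|m IH] x /=; first by rewrite muln0.
have := IH x./2; rewrite expnS; move: (rebase _ _ _) (_ ^ _) => u v.
by case: (odd x); nia.
Qed.

(* A difference of two rebased numbers is [q.+1 ^ d] up to a relative error
   [1 / q]. *)
Lemma rebase_diff q m x y : x < y < 2 ^ m ->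
  exists d, q * rebase q m y < q * rebase q m x + q.+1 * q.+1 ^ d /\
            q * rebase q m x + q * q.+1 ^ d < q * rebase q m y + q.+1 ^ d.
Proof.
elim: m x y => [|m IH] x y /andP[xy ym] /=; first by move: ym; rewrite expn0; lia.
(* [d] is the position of the highest digit where [x] and [y] differ: 0 when the halves agree,
   otherwise one more than for the halves. *)
have [hxy|hxy] := ltnP x./2 y./2; last first.
  have e : x./2 = y./2 by lia.
  have ox : odd x = false by lia.
  have oy : odd y = true by lia.
  exists 0; rewrite ox oy e expn0; move: (rebase _ _ _) => u; nia.
have [|d] := IH x./2 y./2; first by rewrite hxy; rewrite expnS in ym; lia.
move=> [h1 h2]; exists d.+1; rewrite expnS; split;
  move: h1 h2; move: (rebase _ _ x./2) (rebase _ _ y./2) (_ ^ d) => u v w;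
  case: (odd x); case: (odd y); nia.
Qed.

Lemma rebase_lt q m x y : 0 < q -> x < y < 2 ^ m -> rebase q m x < rebase q m y.
Proof.
move=> q0 xy; have [d [_ h]] := rebase_diff q xy.
have : q.+1 ^ d <= q * q.+1 ^ d by rewrite leq_pmull.
nia.
Qed.

(** Division-free form of [(1 - 1/q) u < D < (1 + 1/q) u] with [u = (q+1)^d]. *)
Definition near_pow (q D d : nat) :=
  q * D < q.+1 * q.+1 ^ d /\ q * q.+1 ^ d < q * D + q.+1 ^ d.

(** Ratios of distinct multipliers up to [B] differ from 1 by at least [1/B], well above the
    relative error [1/q] of [near_pow]; so the powers of [q.+1] can be compared in place of [D],
    [E], [F]. *)
Lemma no_scaled_balance (B q p1 p2 p3 D E F d e f : nat) :
  0 < p3 -> p3 < p2 -> p2 < p1 -> p1 <= B -> 7 * B <= q ->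
  near_pow q D d -> near_pow q E e -> near_pow q F f ->
  p1 * E <= p2 * D -> p3 * F <= p2 * D -> p2 * D <= p3 * F + p1 * E -> False.
Proof.
move=> p30 p32 p21 p1B Bq [D1 D2] [E1 E2] [F1 F2] hE hF hD.
have pw k l : k <= l -> q.+1 ^ k <= q.+1 ^ l by move=> kl; rewrite leq_pexp2l.
have pwS k : q.+1 ^ k.+1 = q.+1 * q.+1 ^ k by rewrite expnS.
have u0 k : 0 < q.+1 ^ k by rewrite expn_gt0.
(* If [d <= e], then [p1 E <= p2 D] yields [(p1 - p2) q <= p1 + p2 < 2 B]. *)
have ed : e < d.
  rewrite ltnNge; apply/negP => /pw de.
  have := u0 d; move: de D1 E2 hE {hF hD}; move: (_ ^ e) (_ ^ d) => v u de D1 E2 hE u0'.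
  have h1 : p1 * (q * E) <= p2 * (q * D) by nia.
  have h2 : p2 * (q * D) <= p2 * (q.+1 * u) by rewrite leq_mul2l (ltnW D1) orbT.
  have h3 : p1 * (q * v) <= p1 * (q * E + v) by rewrite leq_mul2l (ltnW E2) orbT.
  have h4 : p1 * (q.-1 * u) <= p1 * (q.-1 * v) by rewrite !leq_mul2l de !orbT.
  have h5 : p1 * (q.-1 * v) + p1 * v = p1 * (q * v) by nia.
  have h6 : p1 * (q.-1 * u) <= p2 * (q.+1 * u) by nia.
  have h7 : p1 * q.-1 <= p2 * q.+1 by move: h6; rewrite !mulnA leq_pmul2r.
  nia.
(* If [d < f], the extra factor [q.+1] in [F] cannot be made up by [p2 <= B]: it would follow that
   [q - 1 <= B]. *)
have fd : f <= d.
  rewrite leqNgt; apply/negP => /pw; rewrite pwS => df.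
  have := u0 d; move: df D1 F2 hF {hE hD}; move: (_ ^ f) (_ ^ d) => v u df D1 F2 hF u0'.
  have h1 : q * F <= B * (q * D) by nia.
  have h2 : B * (q * D) <= B * (q.+1 * u) by rewrite leq_mul2l (ltnW D1) orbT.
  have h3 : q.-1 * v <= B * (q.+1 * u) by nia.
  have h4 : q.-1 * (q.+1 * u) <= q.-1 * v by rewrite leq_mul2l df orbT.
  have h5 : q.-1 <= B.
    by have : q.-1 * (q.+1 * u) <= B * (q.+1 * u); [lia | rewrite leq_pmul2r // muln_gt0].
  lia.
(* After division by [q.+1 ^ d] the last hypothesis reads [(p2 - p3) q <= p3 + B + p2 < 3 B],
   against [7 B <= q]. *)
have := pw _ _ ed; have := pw _ _ fd; have := u0 d; rewrite pwS.
move: D1 D2 E1 F1 hD {E2 F2 hE hF}; move: (_ ^ e) (_ ^ d) (_ ^ f) => w u v.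
move=> D1 D2 E1 F1 hD u0' vu wu.
have h1 : p2 * (q * D) <= p3 * (q * F) + p1 * (q * E) by nia.
have h2 : p3 * (q * F) <= p3 * (q.+1 * u).
  by rewrite leq_mul2l; apply/orP; right; nia.
have h3 : p1 * (q * E) <= B * u.
  apply: leq_mul => //; lia.
have h4 : p2 * (q * u) <= p2 * (q * D + u) by rewrite leq_mul2l (ltnW D2) orbT.
have h5 : p2 * (q * u) <= p3 * (q.+1 * u) + B * u + p2 * u by lia.
have h6 : p2 * q <= p3 * q.+1 + B + p2.
  by rewrite -(leq_pmul2r u0') !mulnDl -!mulnA.
nia.
Qed.

(** Within one row, [T = S + p X(x)] increases with [x], so the column order is the order of [x];
    the last hypothesis is the lexicographic tie-break. *)
Lemma rebase_row_mono q m S p x y :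
  0 < q -> 0 < p -> x < 2 ^ m -> y < 2 ^ m ->
  S + p * rebase q m x <= S + p * rebase q m y ->
  (S + p * rebase q m x = S + p * rebase q m y -> x < y) -> x < y.
Proof.
move=> q0 p0 xB yB; rewrite leq_add2l leq_pmul2l // => h1 h2.
case: (ltngtP x y) => // [yx|e]; last by move: h2; rewrite e => /(_ erefl); rewrite ltnn.
by have := @rebase_lt q m y x q0; rewrite yx xB ltnNge h1 => /(_ isT).
Qed.

Lemma rebase_gap q m x y : 0 < q -> x < y -> y < 2 ^ m ->
  exists D d, rebase q m y = rebase q m x + D /\ near_pow q D d.
Proof.
move=> q0 xy yB; have xyB : x < y < 2 ^ m by rewrite xy.
have [d [h1 h2]] := rebase_diff q xyB; have lt := rebase_lt q0 xyB.
exists (rebase q m y - rebase q m x), d.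
by rewrite subnKC ?(ltnW lt) //; split=> //; split; rewrite mulnBr; nia.
Qed.

Lemma rebase_avoids (m S1 S2 S3 p1 p2 p3 T1 T2 T3 T4 x1 x2 x3 x4 : nat)
    (B := 2 ^ m) (X := rebase (8 * B).-1 m) :
  0 < p3 -> p1 <= B -> S1 <= S2 -> S2 <= S3 -> T1 <= T2 -> T2 <= T3 -> T3 <= T4 ->
  (S1 = S2 -> p2 < p1) -> (S2 = S3 -> p3 < p2) ->
  0 < p1 -> 0 < p2 ->
  (T1 = T3 -> x1 < x3) -> (T1 = T4 -> x1 < x4) -> (T2 = T4 -> x2 < x4) ->
  0 < x1 -> 0 < x4 -> x1 < B -> x2 < B -> x3 < B -> x4 < B ->
  T1 = S1 + p1 * X x1 -> T3 = S1 + p1 * X x3 ->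
  T1 = S2 + p2 * X x1 -> T4 = S2 + p2 * X x4 ->
  T2 = S3 + p3 * X x2 -> T4 = S3 + p3 * X x4 -> False.
Proof.
move=> p30 p1B S12 S23 T12 T23 T34 q12 q23 p10 p20 y13 y14 y24 x10 x40 x1B x2B x3B x4B.
move=> E11 E13 E21 E24 E32 E34.
have B0 : 0 < B by rewrite expn_gt0.
have q0 : 0 < (8 * B).-1 by lia.
have T13 := leq_trans T12 T23; have T24 := leq_trans T23 T34.
have T14 := leq_trans T13 T34.
have {}y13 : x1 < x3.
  by apply: (@rebase_row_mono _ m S1 _ _ _ q0 p10) => //; rewrite -/(X _) -E11 -E13.
have {}y14 : x1 < x4.
  by apply: (@rebase_row_mono _ m S2 _ _ _ q0 p20) => //; rewrite -/(X _) -E21 -E24.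
have {}y24 : x2 < x4.
  by apply: (@rebase_row_mono _ m S3 _ _ _ q0 p30) => //; rewrite -/(X _) -E32 -E34.
have [E [e [eE nE]]] := rebase_gap q0 y13 x3B.
have [D [d [eD nD]]] := rebase_gap q0 y14 x4B.
have [F [f [eF nF]]] := rebase_gap q0 y24 x4B.
(* Columns with [x = 0] are excluded because [X = 0] would say nothing about the multipliers. *)
have n1 : 0 < X x1 by rewrite -[ltnLHS](rebase0 (8 * B).-1 m) rebase_lt ?x10.
have n4 : 0 < X x4 by rewrite -[ltnLHS](rebase0 (8 * B).-1 m) rebase_lt ?x40.
(* Rows 1 and 2 share column 1, so [S1 <= S2] forces [p2 <= p1], and equality would give [S1 = S2].
   Rows 2 and 3 share column 4 in the same way. *)
have p21 : p2 < p1.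
  rewrite ltnNge; apply/negP; rewrite leq_eqVlt => /orP[/eqP h|h].
    have /q12 : S1 = S2 by move: E21; rewrite E11 h => /addIn.
    by rewrite h ltnn.
  by have : p1 * X x1 < p2 * X x1; [rewrite ltn_pmul2r | lia].
have p32 : p3 < p2.
  rewrite ltnNge; apply/negP; rewrite leq_eqVlt => /orP[/eqP h|h].
    have /q23 : S2 = S3 by move: E34; rewrite E24 h => /addIn.
    by rewrite h ltnn.
  by have : p2 * X x4 < p3 * X x4; [rewrite ltn_pmul2r | lia].
(* The three inequalities of [no_scaled_balance] now say [T3 <= T4], [T1 <= T2] and [T2 <= T3]. *)
have t13 : T3 = T1 + p1 * E by rewrite E13 E11 /X eE mulnDr addnA.
have t14 : T4 = T1 + p2 * D by rewrite E24 E21 /X eD mulnDr addnA.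
have t24 : T4 = T2 + p3 * F by rewrite E34 E32 /X eF mulnDr addnA.
by apply: (@no_scaled_balance B (8 * B).-1 p1 p2 p3 D E F d e f) => //; lia.
Qed.

(* Row [i] stands for the pair [(i %/ B, B - i %% B)] = (S, p) and column [j] for
   [(j %/ B, j %% B)] = (T, x); thus rows with equal [S] come by decreasing [p]. *)
Definition dense_rel (m i j : nat) : bool :=
  let B := 2 ^ m in
  (j %% B != 0) &&
  (j %/ B == i %/ B + (B - i %% B) * rebase (8 * B).-1 m (j %% B)).

Lemma ltn_divn_modn (B i j : nat) :
  0 < B -> i < j -> i %/ B <= j %/ B /\ (i %/ B = j %/ B -> i %% B < j %% B).
Proof.
move=> B0 ij; split; first exact/leq_div2r/ltnW.
by move=> e; move: ij; rewrite {1}(divn_eq i B) {1}(divn_eq j B) e ltn_add2l.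
Qed.

Lemma dense_rel_avoids (m i1 i2 i3 j1 j2 j3 j4 : nat) :
  i1 < i2 -> i2 < i3 -> j1 < j2 -> j2 < j3 -> j3 < j4 ->
  dense_rel m i1 j1 -> dense_rel m i1 j3 -> dense_rel m i2 j1 ->
  dense_rel m i2 j4 -> dense_rel m i3 j2 -> dense_rel m i3 j4 -> False.
Proof.
rewrite /dense_rel; set B := 2 ^ m.
have B0 : 0 < B by rewrite expn_gt0.
move=> i12 i23 j12 j23 j34.
have [a12 b12] := ltn_divn_modn B0 i12; have [a23 b23] := ltn_divn_modn B0 i23.
have [c12 _] := ltn_divn_modn B0 j12; have [c23 _] := ltn_divn_modn B0 j23.
have [c34 _] := ltn_divn_modn B0 j34.
have j13 := ltn_trans j12 j23; have j24 := ltn_trans j23 j34.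
have [_ d13] := ltn_divn_modn B0 j13; have [_ d24] := ltn_divn_modn B0 j24.
have [_ d14] := ltn_divn_modn B0 (ltn_trans j12 j24).
move=> /andP[n1 /eqP E11] /andP[_ /eqP E13] /andP[_ /eqP E21] /andP[n4 /eqP E24].
move=> /andP[_ /eqP E32] /andP[_ /eqP E34].
move: n1 n4; rewrite -!lt0n => n1 n4.
apply: (rebase_avoids _ _ a12 a23 c12 c23 c34 _ _ _ _ d13 d14 d24 n1 n4 _ _ _ _
  E11 E13 E21 E24 E32 E34); rewrite ?subn_gt0 ?ltn_pmod ?leq_subr //.
- by move=> /b12; apply: ltn_sub2l; rewrite ltn_pmod.
- by move=> /b23; apply: ltn_sub2l; rewrite ltn_pmod.
Qed.

(** The row and [x] determine the column. Here [S < M], and [p <= B <= 8B - 1] gives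
    [p X(x) < (8B)^m <= M], so [T < 2M]. *)
Lemma dense_rel_exists (m M i x : nat) (B := 2 ^ m) :
  (8 * B) ^ m <= M -> i < M * B -> 0 < x < B ->
  exists2 j, j < 2 * M * B & (j %% B == x) && dense_rel m i j.
Proof.
move=> hM hi /andP[x0 xB]; have B0 : 0 < B by rewrite expn_gt0.
pose T := i %/ B + (B - i %% B) * rebase (8 * B).-1 m x.
have jB : (T * B + x) %/ B = T by rewrite divnMDl // divn_small // addn0.
have jm : (T * B + x) %% B = x by rewrite modnMDl modn_small.
exists (T * B + x); last first.
  by rewrite /dense_rel -/B jm jB !eqxx andbT -lt0n x0.
have h1 : i %/ B < M by rewrite ltn_divLR.
have h2 : (B - i %% B) * rebase (8 * B).-1 m x <= M.
  have := rebase_le (8 * B).-1 m x; rewrite prednK ?muln_gt0 // => h.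
  have : (B - i %% B) * rebase (8 * B).-1 m x <= (8 * B).-1 * rebase (8 * B).-1 m x.
    by apply: leq_mul => //; lia.
  lia.
have : T.+1 * B <= 2 * M * B by rewrite leq_mul2r; rewrite /T; lia.
by rewrite mulSn; lia.
Qed.

(** * The hypergraph of a matrix *)

Section MatrixEdge.
Variables (r : nat) (k : 'I_r -> nat).
Implicit Types (P : pred {dffun forall j : 'I_r, 'I_(k j)}).
Implicit Types (x : {dffun forall j : 'I_r, 'I_(k j)}) (v : matrix_vertex k).

Definition matrix_edge x : {set matrix_vertex k} :=
  [set (Tagged (fun j => 'I_(k j)) (x j) : matrix_vertex k) | j : 'I_r].

Lemma mem_matrix_edge x v : (v \in matrix_edge x) = (x (tag v) == tagged v).
Proof.
apply/imsetP/eqP => [[j _ ->] //|e]; exists (tag v) => //.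
by case: v e => j w /= ->.
Qed.

Lemma card_matrix_edge x : #|matrix_edge x| = r.
Proof. by rewrite card_imset ?card_ord // => i j /(congr1 tag). Qed.

Lemma uniform_matrix_hypergraph P : uniform r (@matrix_hypergraph r k P).
Proof.
by apply/forall_inP => _ /imsetP[x _ ->]; rewrite -/(matrix_edge x) card_matrix_edge.
Qed.

Definition axis (j : 'I_r) : {set matrix_vertex k} := [set v | tag v == j].

(** The axes form a proper partition into [r] intervals, and a single edge already meets [r] blocks
    of any proper partition. *)
Lemma matrix_interval_chromatic_number P :
  (exists x, P x) -> interval_chromatic_number r (@matrix_hypergraph r k P) = r.
Proof.
move=> [x Px]; set H := matrix_hypergraph P.
have xH : matrix_edge x \in H by apply: (imset_f (@matrix_edge)); rewrite inE.
have axis_x y j : matrix_edge y :&: axis j != set0.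
  by apply/set0Pn; exists (Tagged _ (y j)); rewrite !inE mem_matrix_edge !eqxx.
have lb Q : proper_interval_partition r H Q -> r <= #|Q|.
  move=> /and3P[_ _ /forall_inP /(_ _ xH) /eqP er]; rewrite -[leqLHS]er.
  by apply/subset_leq_card/subsetP => B; rewrite inE => /andP[].
apply/eqP; rewrite eqn_leq /interval_chromatic_number; apply/andP; split; last first.
  (* The default value [#|V|] of the minimum is at least [r], since an edge has [r] vertices. *)
  elim/big_ind: _ => [|a b ra rb|//].
    by rewrite -{1}(card_matrix_edge x) max_card.
  by rewrite leq_min ra.
have inj : trivIset (axis @: 'I_r) /\ {in 'I_r &, injective axis}.
  apply: trivIimset => [i j _ _ ij|].
    rewrite -setI_eq0; apply/eqP/setP => v; rewrite !inE.
    by apply/negP => /andP[/eqP -> /eqP e]; rewrite e eqxx in ij.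
  by apply/imsetP => -[j _ e]; have := axis_x x j; rewrite -e setI0 eqxx.
have cardP : #|axis @: 'I_r| = r by rewrite card_in_imset ?card_ord //; case: inj.
rewrite -[leqRHS]cardP -minEnat -leEnat; apply: bigmin_le_cond.
apply/and3P; split.
- apply/and3P; split; last 2 first.
  + by case: inj.
  + by apply/imsetP => -[j _ e]; have := axis_x x j; rewrite -e setI0 eqxx.
  apply/eqP/setP => v; rewrite inE; apply/bigcupP; exists (axis (tag v)).
    exact: imset_f.
  by rewrite inE.
- apply/forall_inP => _ /imsetP[j _ ->]; apply/forall_inP => u; rewrite inE => /eqP uj.
  apply/forall_inP => w; rewrite inE => /eqP wj; apply/forallP => v.
  apply/implyP; rewrite inE !leEsig => /andP[/andP[+ _] /andP[+ _]].
  by rewrite uj wj eq_le => -> ->.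
- apply/forall_inP => _ /imsetP[y _ ->].
  apply/eqP; rewrite -[RHS]cardP; congr #|pred_of_set _|; apply/setP => B; rewrite inE.
  case: imsetP => // -[j _ ->]; exact: axis_x.
Qed.

Lemma lt_matrix_vertex_tag v w : (tag v < tag w)%O -> (v < w)%O.
Proof. by rewrite ltEsig => h; rewrite (ltW h) leNgt h. Qed.

Lemma lt_matrix_vertex_coord (j : 'I_r) (a b : 'I_(k j)) : a < b ->
  ((Tagged (fun i => 'I_(k i)) a : matrix_vertex k) < Tagged (fun i => 'I_(k i)) b)%O.
Proof.
have h := @tagged_asE _ (fun i => 'I_(k i)) (Tagged _ a) b.
by rewrite ltEsig /= lexx /= h.
Qed.

End MatrixEdge.

(** * The forest given by [S0] *)

Section S0Edge.
Variables (r : nat) (hr : 2 <= r).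
Let V := matrix_vertex (@S0r_dim r).
Let i0 : 'I_r := Ordinal (ltnW hr).
Let i1 : 'I_r := Ordinal hr.

(** Axes from 2 on are left unconstrained: having width 1, each contributes its only vertex.
    Natural-number coordinates make membership plain arithmetic. *)
Definition S0_edge (p : nat * nat) : {set V} :=
  [set v : V | ((tag v == 0 :> nat) ==> (tagged v == p.1 :> nat)) &&
               ((tag v == 1 :> nat) ==> (tagged v == p.2 :> nat))].

(* Consecutive entries share a row or a column: the bipartite graph of [S0] is a
   path. *)
Definition S0_path : seq (nat * nat) :=
  [:: (0, 2); (0, 0); (1, 0); (1, 3); (2, 3); (2, 1)].

Lemma S0r_dim_gt0 (j : 'I_r) : 0 < S0r_dim j.
Proof. by case: j => -[|[|[|j]]] //= _; rewrite /S0r_dim /= nth_nil. Qed.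

(** Reduction modulo the width only serves to produce an ordinal on every axis; it changes nothing
    for [p.1 < 3] and [p.2 < 4], and later axes get the default 0. *)
Definition S0_index (p : nat * nat) : {dffun forall j : 'I_r, 'I_(S0r_dim j)} :=
  [ffun j : 'I_r => Ordinal (ltn_pmod (nth 0 [:: p.1; p.2] j) (S0r_dim_gt0 j))].

Lemma S0_index0 a b : a < 3 -> S0_index (a, b) i0 = a :> nat.
Proof. by move=> h; rewrite ffunE /= modn_small. Qed.

Lemma S0_index1 a b : b < 4 -> S0_index (a, b) i1 = b :> nat.
Proof. by move=> h; rewrite ffunE /= modn_small. Qed.

Lemma matrix_edge_S0 x : matrix_edge x = S0_edge (x i0 : nat, x i1 : nat).
Proof.
apply/setP => -[j w]; rewrite mem_matrix_edge inE /=.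
have [j0|j0] := eqVneq (j : nat) 0.
  have e : j = i0 by apply: val_inj.
  by move: w; rewrite e => w /=; rewrite andbT eq_sym -val_eqE.
have [j1|j1] := eqVneq (j : nat) 1.
  have e : j = i1 by apply: val_inj.
  by move: w; rewrite e => w /=; rewrite eq_sym -val_eqE.
have d : S0r_dim j = 1 by case: j j0 j1 {w} => -[|[|[|j]]].
rewrite /=; apply/eqP/val_inj => /=.
by case: (x j) w => [a +] [b +] /=; rewrite d; case: a => //; case: b.
Qed.

Lemma S0_entryP (a : 'I_3) (b : 'I_4) : S0 a b = ((a : nat, b : nat) \in S0_path).
Proof.
by rewrite mxE; case: a => -[|[|[|]]] //; case: b => -[|[|[|[|]]]].
Qed.

Lemma mem_S0_hypergraph e :
  (e \in matrix_hypergraph (S0r hr)) = (e \in map S0_edge S0_path).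
Proof.
apply/imsetP/mapP => [[x]|[[a b] ab ->]].
  rewrite inE /S0r => S0x ->; exists (x i0 : nat, x i1 : nat).
    by rewrite -[_ \in _]S0_entryP.
  exact: matrix_edge_S0.
have [a3 b4] : a < 3 /\ b < 4.
  by move: ab; rewrite !inE => /or4P[/eqP[-> ->]|/eqP[-> ->]|/eqP[-> ->]|/or3P[]/eqP[-> ->]].
exists (S0_index (a, b)); last first.
  by rewrite -/(matrix_edge _) matrix_edge_S0 S0_index0 // S0_index1.
by rewrite inE /S0r S0_entryP S0_index0 // S0_index1.
Qed.

Lemma S0_edge_inj : {in S0_path &, injective S0_edge}.
Proof.
move=> [a b] [c d] ab cd e.
have lt p : p \in S0_path -> p.1 < 3 /\ p.2 < 4.
  by rewrite !inE => /or4P[/eqP->|/eqP->|/eqP->|/or3P[]/eqP->].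
have [/= a3 b4] := lt _ ab; have [/= c3 d4] := lt _ cd.
have : S0_edge (a, b) = matrix_edge (S0_index (a, b)).
  by rewrite matrix_edge_S0 S0_index0 // S0_index1.
rewrite e => {}e.
have m j : Tagged _ (S0_index (a, b) j) \in S0_edge (c, d).
  by rewrite e mem_matrix_edge.
have := m i0; have := m i1.
rewrite !inE; rewrite [tag _]/= [tagged _]/=.
by rewrite S0_index0 // S0_index1 //= andbT => /eqP -> /eqP ->.
Qed.

(** Along the path, at most one of the row and column vertices of an edge recurs later, namely the
    one shared with the next edge; the vertices on the other axes lie in every edge. Hence
    [h = i + 1]. *)
Lemma S0_hypergraph_forest : is_forest (matrix_hypergraph (S0r hr)).
Proof.
exists (map S0_edge S0_path); split.
- by rewrite map_inj_in_uniq //; apply: S0_edge_inj.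
- by move=> e; rewrite mem_S0_hypergraph.
rewrite size_map => i hi; exists i.+1; split=> //.
apply/subsetP => v; rewrite inE.
move: i hi; do 5?[case] => [_|_|_|_|_|//];
  rewrite /index_iota /= !big_cons big_nil /= !inE /=;
  move: (nat_of_ord (tag v)) (nat_of_ord (tagged v)) => t w; lia.
Qed.

Lemma S0r_nonempty : exists x, S0r hr x.
Proof.
by exists (S0_index (0, 0)); rewrite /S0r S0_entryP S0_index0 // S0_index1.
Qed.

End S0Edge.

(** * Hypergraphs with one vertex in each block *)

(** From below, [j <= f j] by induction; from above, [f] rises by at least one at each of the
    [r - 1 - i] steps after [i] and stays below [r]. *)
Lemma increasing_id (r : nat) (f : nat -> nat) :
  {in gtn r &, {homo f : i j / i < j}} -> {in gtn r, forall i, f i < r} ->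
  {in gtn r, f =1 id}.
Proof.
move=> mono bnd i; rewrite inE => ir.
have lo j : j < r -> j <= f j.
  elim: j => // j IH jr; apply: leq_ltn_trans (IH (ltnW jr)) _.
  by apply: mono; rewrite ?inE //; apply: ltnW.
have hi d : i + d < r -> f i + d <= f (i + d).
  elim: d => [|d IH]; first by rewrite !addn0.
  rewrite !addnS => h; apply: leq_ltn_trans (IH (ltnW h)) _.
  by apply: mono; rewrite ?inE //; apply: ltnW.
have := hi (r.-1 - i); rewrite subnKC; last by lia.
have := bnd r.-1; rewrite !inE; have := lo _ ir; lia.
Qed.

Section PartiteHypergraph.
Variables (r N n : nat) (rNn : r * N <= n).
Implicit Types (y : {ffun 'I_r -> 'I_N}).

Lemma block_vertex_subproof (k : 'I_r) (a : 'I_N) : k * N + a < n.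
Proof.
apply: leq_trans rNn; apply: (@leq_trans (k.+1 * N)); last by rewrite leq_mul2r ltn_ord orbT.
by rewrite mulSn addnC ltn_add2r.
Qed.

Definition block_vertex (k : 'I_r) (a : 'I_N) : 'I_n :=
  Ordinal (block_vertex_subproof k a).

Lemma block_vertex_div (k : 'I_r) (a : 'I_N) : block_vertex k a %/ N = k.
Proof.
have N0 : 0 < N by apply: leq_ltn_trans (ltn_ord a).
by rewrite /= divnMDl // divn_small // addn0.
Qed.

Lemma block_vertex_mod (k : 'I_r) (a : 'I_N) : block_vertex k a %% N = a.
Proof. by rewrite /= modnMDl modn_small. Qed.

Lemma block_vertex_inj k l a b :
  block_vertex k a = block_vertex l b -> k = l /\ a = b.
Proof.
by move=> e; split; apply: val_inj; rewrite /= -1?block_vertex_div -1?block_vertex_mod;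
  [rewrite -[LHS](block_vertex_div k a) e block_vertex_div
  |rewrite -[LHS](block_vertex_mod k a) e block_vertex_mod].
Qed.

Definition transversal_edge y : {set 'I_n} := [set block_vertex k (y k) | k : 'I_r].

Lemma card_transversal_edge y : #|transversal_edge y| = r.
Proof. by rewrite card_imset ?card_ord // => k l /block_vertex_inj[]. Qed.

Lemma transversal_edge_inj : injective transversal_edge.
Proof.
move=> y z e; apply/ffunP => k.
have : block_vertex k (y k) \in transversal_edge z by rewrite -e; apply: imset_f.
by case/imsetP => l _ /block_vertex_inj[-> ->].
Qed.

Hypothesis hr : 2 <= r.
Let i0 : 'I_r := Ordinal (ltnW hr).
Let i1 : 'I_r := Ordinal hr.
Variable A : rel nat.

Definition partite_hypergraph : {set {set 'I_n}} :=
  [set transversal_edge y | y : {ffun 'I_r -> 'I_N} & A (y i0) (y i1)].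

Lemma uniform_partite_hypergraph : uniform r partite_hypergraph.
Proof. by apply/forall_inP => _ /imsetP[y _ ->]; rewrite card_transversal_edge. Qed.

Lemma card_partite_hypergraph :
  #|[set p : 'I_N * 'I_N | A p.1 p.2]| * N ^ (r - 2) <= #|partite_hypergraph|.
Proof.
rewrite /partite_hypergraph card_imset; last exact: transversal_edge_inj.
rewrite /i0 /i1; case: r hr => [//|[//|s]] hs.
rewrite subSS subn1 /= -[X in X ^ s](card_ord N) -[X in _ ^ X](card_ord s) -card_ffun.
rewrite -cardsT -cardsX.
(* A pair in [A] fixes the first two coordinates; the other [s = r - 2] are free. *)
pose g (u : ('I_N * 'I_N) * {ffun 'I_s -> 'I_N}) : {ffun 'I_s.+2 -> 'I_N} :=
  [ffun k => if unlift ord0 k is Some k1 then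
               if unlift ord0 k1 is Some k2 then u.2 k2 else u.1.2
             else u.1.1].
have g0 u : g u (Ordinal (ltnW hs)) = u.1.1.
  by rewrite (_ : Ordinal _ = ord0) ?ffunE ?unlift_none //; apply: val_inj.
have g1 u : g u (Ordinal hs) = u.1.2.
  rewrite (_ : Ordinal _ = lift ord0 ord0) ?ffunE ?liftK ?unlift_none //.
  exact: val_inj.
have ginj : injective g.
  move=> u u' e; have e0 := g0 u; have e1 := g1 u.
  rewrite e g0 in e0; rewrite e g1 in e1.
  case: u u' e e0 e1 => [[a b] w] [[a' b'] w'] e /= -> ->; congr (_, _).
  apply/ffunP => k.
  have := congr1 (fun h : {ffun 'I_s.+2 -> 'I_N} => h (lift ord0 (lift ord0 k))) e.
  by rewrite !ffunE !liftK.
rewrite -(card_imset _ ginj); apply/subset_leq_card/subsetP => _ /imsetP[u uA ->].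
by move: uA; rewrite !inE g0 g1 andbT.
Qed.

(* The [i]-th smallest vertex of an edge lies in the [i]-th block, so an embedding
   maps axis [i] into block [i]. *)
Lemma embedding_axis (k : 'I_r -> nat) (f : matrix_vertex k -> 'I_n)
    (x : {dffun forall j : 'I_r, 'I_(k j)}) y :
  (forall v w, (v < w)%O -> (f v < f w)%O) ->
  f @: matrix_edge x = transversal_edge y ->
  forall j : 'I_r, f (Tagged _ (x j)) = block_vertex j (y j).
Proof.
move=> fmono fx j.
pose v i : matrix_vertex k := Tagged (fun j => 'I_(k j)) (x i).
have vE i : {l | f (v i) = block_vertex l (y l)}.
  have : [exists l, f (v i) == block_vertex l (y l)].
    have : f (v i) \in transversal_edge y by rewrite -fx !imset_f.
    by case/imsetP => l _ e; apply/existsP; exists l; apply/eqP.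
  by move=> /existsP /sigW[l /eqP]; exists l.
have r0 : 0 < r by apply: leq_ltn_trans (ltn_ord j).
(* The default [j] of [insubd] only fills in values at [i >= r]. *)
pose g i : nat := tag (vE (insubd j i)).
have gid : {in gtn r, g =1 id}.
  apply: increasing_id => [a b|a]; last by rewrite /g.
  rewrite !inE => ar br ab.
  have lt : (insubd j a < insubd j b)%O by rewrite ltEord !insubdK.
  have /fmono : (v (insubd j a) < v (insubd j b))%O by apply: lt_matrix_vertex_tag.
  (* A transversal edge has one vertex per block, so its increasing vertices lie in strictly
     increasing blocks. *)
  rewrite /g; case: (vE _) (vE _) => /= la -> [/= lb ->] /= h.
  rewrite ltn_neqAle; apply/andP; split.
    apply/eqP => /val_inj e; by rewrite e ltxx in h.
  rewrite -(block_vertex_div la (y la)) -(block_vertex_div lb (y lb)).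
  by apply/leq_div2r/ltnW.
have := gid j; rewrite inE ltn_ord => /(_ isT).
rewrite /g valKd; case: (vE j) => /= l e lj; have {}lj : l = j by apply: val_inj.
by rewrite -[LHS]/(f (v j)) e lj.
Qed.

Hypothesis A_avoids : forall a1 a2 a3 b1 b2 b3 b4 : nat,
  a1 < a2 -> a2 < a3 -> b1 < b2 -> b2 < b3 -> b3 < b4 ->
  A a1 b1 -> A a1 b3 -> A a2 b1 -> A a2 b4 -> A a3 b2 -> A a3 b4 -> False.

Lemma partite_hypergraph_avoids :
  ~~ contains (matrix_hypergraph (S0r hr)) partite_hypergraph.
Proof.
apply/negP => /existsP[B /existsP[F /andP[/andP[FG _] /existsP[f /and3P[fmono _ fF]]]]].
have {}fmono v w : (v < w)%O -> (f v < f w)%O.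
  by move: fmono => /forallP /(_ v) /forallP /(_ w) /eqP <-.
pose R (a : 'I_3) : nat := f (Tagged (fun j : 'I_r => 'I_(S0r_dim j)) (a : 'I_(S0r_dim i0))).
pose C (b : 'I_4) : nat := f (Tagged (fun j : 'I_r => 'I_(S0r_dim j)) (b : 'I_(S0r_dim i1))).
(* Columns land in block 1, which starts at [N]; the bound [N <= C b] keeps truncated subtraction
   strictly monotone. *)
have AE (a : 'I_3) (b : 'I_4) : S0 a b -> A (R a) (C b - N) /\ N <= C b.
  move=> ab; pose x := S0_index r (a : nat, b : nat).
  have xa : x i0 = a by apply: val_inj; exact: S0_index0.
  have xb : x i1 = b by apply: val_inj; exact: S0_index1.
  have : f @: matrix_edge x \in partite_hypergraph.
    apply: (subsetP FG); rewrite -(eqP fF); apply: imset_f; apply: (imset_f (@matrix_edge _ _)).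
    by rewrite inE /S0r xa xb.
  case/imsetP => y; rewrite inE => Ay /(embedding_axis fmono) fx.
  have -> : R a = y i0 by rewrite /R -xa fx /= mul0n.
  have -> : C b = N + y i1 by rewrite /C -xb fx /= mul1n.
  by rewrite addKn leq_addr.
have Rlt (a a' : 'I_3) : a < a' -> R a < R a'.
  move=> aa'; have : (f (Tagged (fun j => 'I_(S0r_dim j)) (a : 'I_(S0r_dim i0)))
      < f (Tagged (fun j => 'I_(S0r_dim j)) (a' : 'I_(S0r_dim i0))))%O.
    by exact/fmono/lt_matrix_vertex_coord.
  by rewrite ltEord.
have Clt (b b' : 'I_4) : b < b' -> C b < C b'.
  move=> bb'; have : (f (Tagged (fun j => 'I_(S0r_dim j)) (b : 'I_(S0r_dim i1)))
      < f (Tagged (fun j => 'I_(S0r_dim j)) (b' : 'I_(S0r_dim i1))))%O.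
    by exact/fmono/lt_matrix_vertex_coord.
  by rewrite ltEord.
have {}AE a b : a < 3 -> b < 4 -> (a, b) \in S0_path ->
    A (R (inord a)) (C (inord b) - N) /\ N <= C (inord b).
  by move=> a3 b4 ab; apply: AE; rewrite S0_entryP !inordK.
have [A11 N1] := AE 0 0 isT isT isT; have [A13 N3] := AE 0 2 isT isT isT.
have [A21 _] := AE 1 0 isT isT isT; have [A24 N4] := AE 1 3 isT isT isT.
have [A32 N2] := AE 2 1 isT isT isT; have [A34 _] := AE 2 3 isT isT isT.
apply: (A_avoids _ _ _ _ _ A11 A13 A21 A24 A32 A34); rewrite ?ltn_sub2rE //;
  solve [apply: Rlt; rewrite !inordK // | apply: Clt; rewrite !inordK //].
Qed.

Lemma Ex_S0_ge :
  #|[set p : 'I_N * 'I_N | A p.1 p.2]| * N ^ (r - 2)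
    <= Ex r (matrix_hypergraph (S0r hr)) n.
Proof.
apply: leq_trans card_partite_hypergraph _.
apply: (bigop.leq_bigmax_cond partite_hypergraph).
by rewrite uniform_partite_hypergraph partite_hypergraph_avoids.
Qed.

End PartiteHypergraph.

(** * Asymptotics *)

(** Each of the [M * B] rows has a 1 for every nonzero residue [x] modulo [B], in distinct columns
    since [x] is the residue of the column. *)
Lemma dense_rel_count (m M N : nat) (B := 2 ^ m) :
  (8 * B) ^ m <= M -> 2 * M * B <= N ->
  M * B * B.-1 <= #|[set p : 'I_N * 'I_N | dense_rel m p.1 p.2]|.
Proof.
move=> hM hN; have B0 : 0 < B by rewrite expn_gt0.
have col (u : 'I_(M * B) * 'I_B.-1) :
    {j | j < N & (j %% B == u.2.+1) && dense_rel m u.1 j}.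
  apply: sig2W; have [||j jN hj] := @dense_rel_exists m M u.1 u.2.+1 hM.
  - exact: ltn_ord.
  - by have := ltn_ord u.2; lia.
  - by exists j => //; apply: leq_trans hN.
have row (u : 'I_(M * B) * 'I_B.-1) : u.1 < N.
  by have := ltn_ord u.1; lia.
pose g u : 'I_N * 'I_N :=
  (Ordinal (row u), Ordinal (s2valP (col u))).
have gE u : ((g u).2 : nat) %% B = u.2.+1 /\ dense_rel m (g u).1 (g u).2.
  by rewrite /g /=; case: (col u) => j jN /= /andP[/eqP].
have ginj : injective g.
  move=> u u' e; have [e2 _] := gE u; rewrite e (gE u').1 in e2.
  have /(congr1 val) /= e1 := congr1 fst e.
  by case: u u' {e} e1 e2 => [i x] [i' x'] /= /val_inj -> [/val_inj ->].
rewrite -[X in X * _]card_ord -[X in _ * X]card_ord -card_prod -(card_imset _ ginj).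
by apply/subset_leq_card/subsetP => _ /imsetP[u _ ->]; rewrite inE; case: (gE u).
Qed.

Lemma Ex_S0_ge_pow (r n m : nat) (hr : 2 <= r) (N := n %/ r) :
  0 < m -> 2 ^ (m + 2) ^ 2 <= N ->
  N ^ (r - 1) * 2 ^ m <= 8 * Ex r (matrix_hypergraph (S0r hr)) n.
Proof.
move=> m0 hN; have rN : r * N <= n by rewrite mulnC leq_divM.
set B := 2 ^ m; have B1 : 1 < B by rewrite -[1]/(2 ^ 0) ltn_exp2l.
pose M := N %/ (2 * B).
(* [(8B)^m * 2B = 2^(m^2 + 4m + 1)], below [2^((m + 2)^2) <= N]. *)
have hM : (8 * B) ^ m <= M.
  rewrite leq_divRL ?muln_gt0 ?(ltnW B1) //; apply: leq_trans hN.
  rewrite /B -[8]/(2 ^ 3) -[in 2 * _](expn1 2) -!expnD -expnM -expnD leq_exp2l //; nia.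
have hMN : 2 * M * B <= N by rewrite mulnAC mulnC leq_divM.
have M0 : 0 < M by apply: leq_trans hM; rewrite expn_gt0 muln_gt0 (ltnW B1).
have NM : N <= 4 * (M * B).
  have : N < M.+1 * (2 * B) by apply: ltn_ceil; rewrite muln_gt0 (ltnW B1).
  nia.
have := Ex_S0_ge rN hr (@dense_rel_avoids m).
have := dense_rel_count hM hMN; rewrite -/B.
have -> : r - 1 = (r - 2).+1 by lia.
rewrite expnS; set c := #|_|; set E := Ex _ _ _ => h1 h2.
(* The factor 8 combines [N <= 4 M B] with [B <= 2 (B - 1)]. *)
have h3 : N * B <= 8 * c by nia.
have : 8 * (c * N ^ (r - 2)) <= 8 * E by rewrite leq_mul2l h2 orbT.
apply: leq_trans; rewrite mulnA mulnAC leq_mul2r h3 orbT //.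
Qed.

(** The integer [u] stands for an upper bound of [sqrt(log n)], which keeps the estimate within the
    naturals. *)
Lemma Ex_S0_growth (r : nat) (hr : 2 <= r) :
  exists K n0, forall n, n0 <= n -> exists2 u, n <= 2 ^ u ^ 2 &
    n ^ (r - 1) * 2 ^ u <= K * Ex r (matrix_hypergraph (S0r hr)) n.
Proof.
(* The factors of [K] pay for [n <= 2 r N], for [u - m = 2 r + 3], and for the 8 of [Ex_S0_ge_pow];
   the threshold makes [m = 1] admissible. *)
exists ((2 * r) ^ (r - 1) * 2 ^ (2 * r + 3) * 8), (r * 2 ^ 9) => n nr.
have r0 : 0 < r by lia.
set N := n %/ r; have hN : 2 ^ 9 <= N by rewrite leq_divRL // mulnC.
have nN : n <= 2 * r * N.
  have : n < N.+1 * r by apply: ltn_ceil.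
  nia.
have N9 : 2 ^ (1 + 2) ^ 2 <= N by [].
pose P m := 2 ^ (m + 2) ^ 2 <= N.
have exP : exists m, P m by exists 1.
have boundP m : P m -> m <= N.
  move=> Pm; have := @ltn_expl 2 ((m + 2) ^ 2) isT; rewrite /P in Pm *; nia.
have [m Pm maxm] := ex_maxnP exP boundP.
have m0 : 0 < m by exact: maxm.
have hm : N < 2 ^ (m + 3) ^ 2.
  rewrite ltnNge; apply/negP => h.
  by have := maxm m.+1; rewrite /P addSnnS => /(_ h); rewrite ltnn.
exists (m + 2 * r + 3).
  apply: leq_trans nN _; apply: (@leq_trans (2 ^ (2 * r) * 2 ^ (m + 3) ^ 2)).
    by apply: leq_mul; apply/ltnW => //; apply: ltn_expl.
  rewrite -expnD leq_exp2l //; nia.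
have := Ex_S0_ge_pow hr m0 Pm; set E := Ex _ _ _ => hE.
apply: (@leq_trans ((2 * r * N) ^ (r - 1) * 2 ^ (m + 2 * r + 3))).
  by rewrite leq_mul2r leq_exp2r ?nN ?orbT //; lia.
have -> : m + 2 * r + 3 = m + (2 * r + 3) by lia.
rewrite expnMn expnD.
have : (2 * r) ^ (r - 1) * 2 ^ (2 * r + 3) * (N ^ (r - 1) * 2 ^ m) <=
       (2 * r) ^ (r - 1) * 2 ^ (2 * r + 3) * (8 * E) by rewrite leq_mul2l hE orbT.
by rewrite -!mulnA; congr (_ <= _); ring.
Qed.

(* Imported only here: the notations of classical_sets would shadow finset's. *)
From mathcomp Require Import classical_sets reals topology normedtype landau exp.
Import numFieldNormedType.Exports.

Local Open Scope classical_set_scope.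
Local Open Scope ring_scope.

(** * Real-valued asymptotic bounds *)

Lemma log2_exp2n (R : realType) (k : nat) : log2 (2 ^+ k : R) = k%:R.
Proof.
have l2 : (0 : R) < ln 2 by rewrite ln_gt0 // ltr1n.
by rewrite /log2 lnXn // -[_ *+ k]mulr_natl mulfK // gt_eqF.
Qed.

Lemma sqrt_log2_le (R : realType) (n u : nat) :
  (0 < n)%N -> (n <= 2 ^ u ^ 2)%N -> Num.sqrt (log2 (n%:R : R)) <= u%:R.
Proof.
move=> n0 nu; have l2 : (0 : R) < ln 2 by rewrite ln_gt0 // ltr1n.
have -> : u%:R = Num.sqrt (u%:R ^+ 2) :> R by rewrite sqrtr_sqr ger0_norm.
apply: ler_wsqrtr; rewrite -natrX -[(u ^ 2)%:R]log2_exp2n /log2 ler_pM2r ?invr_gt0 //.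
by rewrite ler_ln ?posrE ?ltr0n ?exprn_gt0 // -natrX ler_nat.
Qed.

Lemma Ex_S0_omega (R : realType) (r : nat) (hr : (2 <= r)%N) :
  (fun n : nat => (Ex r (matrix_hypergraph (S0r hr)) n)%:R : R) =Omega_\oo
    (fun n : nat => n%:R ^+ (r - 1) * 2 `^ (Num.sqrt (log2 n%:R) - 0)).
Proof.
have [K [n0 hK]] := Ex_S0_growth hr.
rewrite eqOmegaE eqOmegaO; apply/eqO_exP; exists (K.+1%:R); first by rewrite ltr0n.
exists (maxn 1 n0) => // n /=; rewrite geq_max => /andP[n1 /hK[u nu hE]].
rewrite !ger0_norm ?mulr_ge0 ?exprn_ge0 ?powR_ge0 // subr0.
apply: (@le_trans _ _ (n%:R ^+ (r - 1) * 2 ^+ u)).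
  rewrite ler_wpM2l ?exprn_ge0 // -powR_mulrn // ler_powR ?ler1n //.
  exact: sqrt_log2_le.
rewrite -!natrX -!natrM ler_nat; apply: leq_trans hE _.
by rewrite leq_mul2r leqnSn orbT.
Qed.

Lemma exp2_affine_unbounded (a b : nat) :
  forall i0, exists2 i, (i0 <= i)%N & (b + 2 * i * a < 2 ^ i)%N.
Proof.
(* With [i = 2t], [2^i = (2^t)^2 >= (t + 1)^2], while [b + 4 a t <= t + t^2]. *)
move=> i0; pose t := (i0 + b + 4 * a)%N; exists (2 * t)%N; first by rewrite /t; lia.
have := @ltn_expl 2 t isT; rewrite [(2 * t)%N]mulnC expnM -mulnn.
rewrite /t; nia.
Qed.

(** Along [n = 2^(j^2)] with [j = 2^i], [log n] is exactly [2^(2i)]: a polylogarithmic factor is at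
    most [2^(2ia)], whereas the growth bound forces [2^(2^i)] up to a constant. *)
Lemma Ex_S0_not_polylog (R : realType) (r : nat) (hr : (2 <= r)%N) (c : R) :
  ~ (fun n : nat => (Ex r (matrix_hypergraph (S0r hr)) n)%:R : R) =O_\oo
      (fun n : nat => n%:R ^+ (r - 1) * (log2 n%:R) `^ c).
Proof.
move=> /eqO_exP[k k0 [n1 _ hn1]].
have [K [n0 hK]] := Ex_S0_growth hr.
(* [a] rounds the exponent up to a natural number, and [w] collects both implied constants. *)
pose a := Num.bound `|c|; pose w := (K * Num.bound k)%N.
have [i ile hi] := exp2_affine_unbounded a w (n0 + n1).
pose j := (2 ^ i)%N; pose n := (2 ^ j ^ 2)%N.
have nj : (n0 + n1 <= n)%N.
  apply: leq_trans ile _.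
  have h1 : (i <= j)%N by apply/ltnW/ltn_expl.
  have h2 : (j <= j ^ 2)%N by rewrite -[leqLHS]expn1 leq_pexp2l // expn_gt0.
  by apply: leq_trans h1 (leq_trans h2 (ltnW _)); apply: ltn_expl.
have [u nu hE] := hK n (leq_trans (leq_addr _ _) nj).
have ju : (j <= u)%N by rewrite -leq_sqr -(@leq_exp2l 2).
have := hn1 n (leq_trans (leq_addl _ _) nj).
have -> : log2 (n%:R : R) = (2 ^ (2 * i))%:R.
  by rewrite /n natrX log2_exp2n /j -expnM mulnC.
rewrite /= !ger0_norm ?mulr_ge0 ?exprn_ge0 ?powR_ge0 // => hO.
set E := Ex _ _ _ in hE hO.
have ca : (2 ^ (2 * i))%:R `^ c <= (2 ^ (2 * i * a))%:R :> R.
  rewrite (expnM _ _ a) [leRHS]natrX -powR_mulrn // ler_powR ?ler1n ?expn_gt0 //.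
  by apply: le_trans (ler_norm c) (ltW _); rewrite /a; apply: archi_boundP.
have kb : k <= (Num.bound k)%:R by apply/ltW/archi_boundP/ltW.
have hEn : (E <= Num.bound k * (n ^ (r - 1) * 2 ^ (2 * i * a)))%N.
  rewrite -(ler_nat R) (le_trans hO) // !natrM; apply: ler_pM => //.
  - exact: ltW.
  - by rewrite mulr_ge0 ?exprn_ge0 ?powR_ge0.
  by rewrite [(n ^ _)%:R]natrX; apply: ler_wpM2l; rewrite ?exprn_ge0.
have : (n ^ (r - 1) * 2 ^ j <= n ^ (r - 1) * (w * 2 ^ (2 * i * a)))%N.
  apply: leq_trans (leq_trans hE _); first by rewrite leq_mul2l leq_exp2l // ju orbT.
  apply: leq_trans (leq_mul (leqnn K) hEn) _.
  by rewrite /w !mulnA leq_eqVlt; apply/orP; left; apply/eqP; ring.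
rewrite leq_pmul2l ?expn_gt0 ?expn_gt0 //; apply/negP; rewrite -ltnNge.
apply: (@leq_ltn_trans (2 ^ (w + 2 * i * a))); last by rewrite ltn_exp2l.
by rewrite expnD leq_mul2r; apply/orP; right; apply/ltnW/ltn_expl.
Qed.

Theorem mainTheorem5 (R : realType) (r : nat) (hr : (2 <= r)%N) :
  let H := matrix_hypergraph (S0r hr) in
  [/\ uniform r H,
      is_forest H,
      interval_chromatic_number r H = r,
      exists g : nat -> R,
        (g =O_\oo (fun n : nat => log2 (log2 (n%:R : R)))) /\
        ((fun n : nat => (Ex r H n)%:R : R) =Omega_\oo
          (fun n : nat => n%:R ^+ (r - 1) * 2 `^ (Num.sqrt (log2 n%:R) - g n)))
    & ~ (forall (d : Order.disp_t) (V : finOrderType d) (F : {set {set V}}),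
          uniform r F -> is_forest F -> interval_chromatic_number r F = r ->
          exists c : R,
            (fun n : nat => (Ex r F n)%:R : R) =O_\oo
              (fun n : nat => n%:R ^+ (r - 1) * (log2 n%:R) `^ c))].
Proof.
move=> H.
have Hu : uniform r H by apply: uniform_matrix_hypergraph.
have Hf : is_forest H by apply: S0_hypergraph_forest.
have Hc : interval_chromatic_number r H = r.
  exact/matrix_interval_chromatic_number/S0r_nonempty.
split=> //.
- exists (fun=> 0); split; last exact: Ex_S0_omega.
  by apply/eqO_exP; exists 1 => //; near=> n; rewrite normr0 mul1r.
- by move=> /(_ _ _ H Hu Hf Hc)[c]; apply: Ex_S0_not_polylog.
Unshelve. all: by end_near.
Qed.
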